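(* Let $n\ge 2$, let $Q$ be a quiver of type $A_{n-1}$, and let $A$ be the Cartan matrix of type $A_{n-1}$. Consider the two $q$-series identities $$(\mathrm{I})\qquad \sum_{{\bf k}=(k_1,\dots,k_{n-1})\in\mathbb{Z}_{\ge 0}^{n-1}}\frac{{\bf x}^{\bf k}}{\prod_{i=1}^{n-1}(q)_{k_i}}=\sum_{\eta}\frac{q^{\mathrm{codim}(\eta)}{\bf x}^{\overline{\dim}(\eta)}}{\prod_{1\le i\le j\le n-1}(q)_{m_{[i,j]}(\eta)}},$$ where $\eta$ runs over all finite-dimensional representations of $Q$ up to isomorphism, and $$(\mathrm{II})\qquad \sum_{{\bf m}\in\mathbb{Z}_{\ge 0}^{n(n-1)/2}}\frac{q^{B'({\bf m})}x_1^{\lambda_1}\cdots x_{n-1}^{\lambda_{n-1}}}{\prod_{1\le i<j\le n}(q)_{m_{i,j}}}=\sum_{{\bf k}=(k_1,\dots,k_{n-1})\in\mathbb{Z}_{\ge 0}^{n-1}}\frac{q^{\frac12{\bf k}A{\bf k}^\top}x_1^{k_1}\cdots x_{n-1}^{k_{n-1}}}{(q)_{k_1}(q)_{k_2}\cdots(q)_{k_{n-1}}},$$ where ${\bf m}=(m_{i,j})_{1\le i<j\le n}$, $\lambda_i=\sum_{1\le s\le i,\ i<\ell\le n}m_{s,\ell}$, and $$B'({\bf m})=\sum_{\substack{1\le i_1<j_1\le n\\ 1\le i_2<j_2\le n\\ 1\le i_1\le i_2\le n\\ 1\le j_1\le j_2\le n\\ j_1>i_2}}m_{i_1,j_1}m_{i_2,j_2}.$$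 Then the identities (I) and (II) are equivalent (in the sense defined in the context, with the summation variables identified by $m_{[i,j]}=m_{i,j+1}$ for $1\le i\le j\le n-1$).
   Context: Notation: $(q)_k=\prod_{i=1}^k(1-q^i)$, $(q)_0=1$; ${\bf x}^{\bf k}=x_1^{k_1}\cdots x_{n-1}^{k_{n-1}}$. The Cartan matrix of type $A_{n-1}$ has entries $2$ on the diagonal, $-1$ when $|i-j|=1$, and $0$ otherwise. A quiver of type $A_{n-1}$ has vertices $1,\dots,n-1$ and one arrow $a_i$ between $i$ and $i+1$ for each $1\le i\le n-2$. Its indecomposable representations are in one-to-one correspondence with segments $[i,j]$, $1\le i\le j\le n-1$ (the positive roots of $A_{n-1}$); $m_{[i,j]}(\eta)$ is the multiplicity of $[i,j]$ in $\eta$, and $\overline{\dim}(\eta)$ is the dimension vector of $\eta$, with $i$-th entry $\sum_{s\le i\le t}m_{[s,t]}(\eta)$. The quantity $\mathrm{codim}(\eta)$ (the codimension of the orbit of $\eta$) is given by $\mathrm{codim}(\eta)=\sum_{[I,J]}m_I(\eta)\, m_J(\eta)$, the sum over pairs of segments satisfying one of: (1) $I=[w,x-1]$, $J=[x,z]$ with $w<x\le z$; (2) $I=[w,y]$, $J=[x,z]$ with $w<x\le y<z$ and the arrows $a_{x-1}$ and $a_y$ point in the same direction; (3) $I=[x,y]$, $J=[w,z]$ with $w<x\le y<z$ and the arrows $a_{x-1}$ and $a_y$ point in different directions. Equivalence of identities: an identity $\sum_{\bf n}\frac{q^{\frac12{\bf n}A{\bf n}^\top}{\bf x}^{\bf n}}{(q)_{n_1}\cdots(q)_{n_k}}=\sum_{\bf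 m}\frac{q^{B({\bf m})}{\bf x}^{U{\bf m}}}{(q)_{m_1}\cdots(q)_{m_\ell}}$ (sums over ${\bf n}\in\mathbb{Z}_{\ge0}^k$, ${\bf m}\in\mathbb{Z}_{\ge0}^\ell$, with $B$ a quadratic form and $U$ a $k\times\ell$ matrix) is called equivalent to $\sum_{\bf n}\frac{q^{\frac12{\bf n}\tilde A{\bf n}^\top}{\bf x}^{\bf n}}{(q)_{n_1}\cdots(q)_{n_k}}=\sum_{\bf m}\frac{q^{\tilde B({\bf m})}{\bf x}^{U{\bf m}}}{(q)_{m_1}\cdots(q)_{m_\ell}}$ (same $U$) if $B({\bf m})-\frac12{\bf n}A{\bf n}^\top=\tilde B({\bf m})-\frac12{\bf n}\tilde A{\bf n}^\top$ for all ${\bf n}$, ${\bf m}$ with $U{\bf m}={\bf n}$. Identity (I) has this shape with zero quadratic form on the ${\bf k}$-side and $\mathrm{codim}(\eta)$, as a quadratic form in the multiplicities $m_{[i,j]}(\eta)$, on the other side.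
   Formalization: The quiver Q is additionally assumed to be linearly oriented (all arrows a_i point in the same direction); for any other orientation the claimed equivalence is false, e.g. n=4 with a_1, a_2 in different directions and m_[2,2]=m_[1,3]=1. *)

(* Defs.v *)
From HB Require Import structures.
From mathcomp Require Import all_boot all_order all_algebra.
From mathcomp Require Import zify ring lra.
From mathcomp Require Import all_classical all_reals all_analysis.

Set Implicit Arguments.
Unset Strict Implicit.
Unset Printing Implicit Defensive.

Import Order.TTheory GRing.Theory Num.Theory.
Local Open Scope ring_scope.

(** * Fermionic identities and their equivalence *)

(* The data (A, B, U) of the identity
     \sum_n q^(n A n^T / 2) x^n / \prod_i (q)_(n_i)
       = \sum_m q^(B m) x^(U m) / \prod_j (q)_(m_j),
   where n ranges over N^r and m over N^M.  What it asserts is [qid_holds]. *)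
Record qident (r : nat) (M : finType) := QIdent {
  qidA : 'M[rat]_r;
  qidB : {ffun M -> nat} -> rat;
  qidB_quadratic : exists b : M -> M -> rat, forall m : {ffun M -> nat},
    qidB m = \sum_(i : M) \sum_(j : M) b i j * (m i)%:R * (m j)%:R;
  qidU : 'I_r -> M -> nat }.

Definition halfform r (A : 'M[rat]_r) (k : {ffun 'I_r -> nat}) : rat :=
  let v : 'rV[rat]_r := \row_i (k i)%:R in
  1 / 2 * (v *m A *m v^T) 0 0.

Definition mulU r (M : finType) (U : 'I_r -> M -> nat) (m : {ffun M -> nat}) :
  {ffun 'I_r -> nat} := [ffun i => (\sum_(j : M) U i j * m j)%N].

Definition qfact (R : realType) (q : R) (k : nat) : R :=
  \prod_(1 <= i < k.+1) (1 - q ^+ i).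

Definition monom (R : realType) r (x : 'I_r -> R) (k : {ffun 'I_r -> nat}) : R :=
  \prod_(i < r) x i ^+ k i.

(* Rendered with sums in [0, +oo]: for the two identities below, whose sums
   converge for small x and whose coefficients are nonnegative as q-series,
   equality of formal series amounts to equality of the two sums for all real
   0 < q < 1 and x_i >= 0. *)
Definition qid_holds r (M : finType) (D : qident r M) : Prop :=
  forall (R : realType) (q : R) (x : 'I_r -> R),
    0 < q -> q < 1 -> (forall i, 0 <= x i) ->
    (\esum_(k in [set: {ffun 'I_r -> nat}])
       (q `^ ratr (halfform (qidA D) k) * monom x k /
          \prod_(i < r) qfact q (k i))%:E
     = \esum_(m in [set: {ffun M -> nat}])
       (q `^ ratr (qidB D m) * monom x (mulU (qidU D) m) /
          \prod_(j : M) qfact q (m j))%:E)%E.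

(* Equivalence of two identities whose m-variables are identified through
   [phi]; both have the same U after this identification. *)
Definition equivalent_via r (M1 M2 : finType) (phi : M1 -> M2)
    (D1 : qident r M1) (D2 : qident r M2) : Prop :=
  [/\ bijective phi,
      forall i j, qidU D1 i j = qidU D2 i (phi j) &
      forall (k : {ffun 'I_r -> nat})
             (m1 : {ffun M1 -> nat}) (m2 : {ffun M2 -> nat}),
        (forall j, m1 j = m2 (phi j)) ->
        mulU (qidU D1) m1 = k ->
        qidB D1 m1 - halfform (qidA D1) k = qidB D2 m2 - halfform (qidA D2) k].

(** * Quivers of type A_(n-1) and segments *)

(* Vertices are 'I_n.-1 and arrows 'I_n.-2, numbered from 0: arrow a joins a and
   a+1, and points to a+1 iff [Q a]. *)
Definition quiverA (n : nat) : Type := 'I_n.-2 -> bool.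

Definition equioriented n (Q : quiverA n) : Prop := forall a b, Q a = Q b.

Definition segment (n : nat) : finType :=
  {s : 'I_n.-1 * 'I_n.-1 | (s.1 <= s.2)%N}.

Definition lo n (s : segment n) : nat := (val s).1.
Definition hi n (s : segment n) : nat := (val s).2.

(* The arrows a_(x-1) and a_y point in the same (different) direction. *)
Definition same_dir n (Q : quiverA n) (x y : nat) : bool :=
  [exists a : 'I_n.-2, exists b : 'I_n.-2,
    [&& a.+1 == x, b == y :> nat & Q a == Q b]].
Definition diff_dir n (Q : quiverA n) (x y : nat) : bool :=
  [exists a : 'I_n.-2, exists b : 'I_n.-2,
    [&& a.+1 == x, b == y :> nat & Q a != Q b]].

Definition codim_pair n (Q : quiverA n) (I J : segment n) : bool :=
  [|| (hi I).+1 == lo J,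
      [&& (lo I < lo J)%N, (lo J <= hi I)%N, (hi I < hi J)%N
        & same_dir Q (lo J) (hi I)]
    | [&& (lo J < lo I)%N, (lo I <= hi I)%N, (hi I < hi J)%N
        & diff_dir Q (lo I) (hi I)]].

(* A representation of Q up to isomorphism is given by its multiplicities. *)
Definition codim n (Q : quiverA n) (m : {ffun segment n -> nat}) : nat :=
  (\sum_(I : segment n) \sum_(J : segment n | codim_pair Q I J) m I * m J)%N.

Lemma quadratic_pairs (M : finType) (P : rel M) :
  exists b : M -> M -> rat, forall m : {ffun M -> nat},
    ((\sum_(i : M) \sum_(j : M | P i j) m i * m j)%N)%:R
      = \sum_(i : M) \sum_(j : M) b i j * (m i)%:R * (m j)%:R :> rat.
Proof.
exists (fun i j => (P i j)%:R) => m.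
rewrite natr_sum; apply: eq_bigr => i _.
rewrite natr_sum big_mkcond; apply: eq_bigr => j _.
by case: (P i j); rewrite ?natrM ?mul1r ?mul0r.
Qed.

(* [qidU] encodes the dimension vector. *)
Definition identityI n (Q : quiverA n) : qident n.-1 (segment n) := {|
  qidA := 0;
  qidB := fun m => (codim Q m)%:R;
  qidB_quadratic := quadratic_pairs (codim_pair Q);
  qidU := fun i s => ((lo s <= i) && (i <= hi s))%N : nat |}.

(** * The identity for the Cartan matrix *)

Definition cartanA (r : nat) : 'M[rat]_r :=
  \matrix_(i, j) if i == j then 2
                 else if (i.+1 == j) || (j.+1 == i) then - 1 else 0.

(* (i, j) stands for the 1-based pair (i+1, j+1). *)
Definition ipair (n : nat) : finType := {p : 'I_n * 'I_n | (p.1 < p.2)%N}.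

Definition fst_ix n (p : ipair n) : nat := (val p).1.
Definition snd_ix n (p : ipair n) : nat := (val p).2.

Definition Bprime_pair n (p p' : ipair n) : bool :=
  [&& (fst_ix p <= fst_ix p')%N, (snd_ix p <= snd_ix p')%N
    & (fst_ix p' < snd_ix p)%N].

Definition Bprime n (m : {ffun ipair n -> nat}) : nat :=
  (\sum_(p : ipair n) \sum_(p' : ipair n | Bprime_pair p p') m p * m p')%N.

(* [qidU] encodes the exponents lambda_i. *)
Definition identityII n : qident n.-1 (ipair n) := {|
  qidA := cartanA n.-1;
  qidB := fun m => (Bprime m)%:R;
  qidB_quadratic := quadratic_pairs (@Bprime_pair n);
  qidU := fun i p => ((fst_ix p <= i) && (i < snd_ix p))%N : nat |}.

(* The identification m_[i,j] = m_(i,j+1). *)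
Definition lower_ix n (i : 'I_n.-1) : 'I_n := widen_ord (leq_pred n) i.

Fact upper_ix_subproof n (i : 'I_n.-1) : (i.+1 < n)%N.
Proof. by case: n i => [|n] [i]. Qed.
Definition upper_ix n (i : 'I_n.-1) : 'I_n := Ordinal (upper_ix_subproof i).

Fact seg_pair_subproof n (s : segment n) :
  let p := (lower_ix (val s).1, upper_ix (val s).2) in (p.1 < p.2)%N.
Proof. exact: (valP s). Qed.
Definition seg_pair n (s : segment n) : ipair n :=
  exist _ (lower_ix (val s).1, upper_ix (val s).2) (seg_pair_subproof s).

(** * Equivalence forces a linear orientation *)

(* codim depends on the orientation of Q (through [same_dir] and [diff_dir]), the
   other terms of the equivalence do not.  If two consecutive arrows of Q differ
   (which needs n >= 4), the equivalence fails, so that [equioriented Q] cannot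
   be dropped as a hypothesis. *)

Definition two_point (M : finType) (s t : M) : {ffun M -> nat} :=
  [ffun i => (i == s) + (i == t)]%N.

Lemma sum_two_point (M : finType) (s t : M) (F : M -> nat) :
  (\sum_i two_point s t i * F i = F s + F t)%N.
Proof.
under eq_bigr => i _ do rewrite ffunE mulnDl.
rewrite big_split /=; congr (_ + _)%N.
- rewrite (bigD1 s) //= eqxx mul1n big1 ?addn0 // => i.
  by move=> /negPf ->; rewrite mul0n.
- rewrite (bigD1 t) //= eqxx mul1n big1 ?addn0 // => i.
  by move=> /negPf ->; rewrite mul0n.
Qed.

Lemma pairs_two_point (M : finType) (P : rel M) (s t : M) :
  (\sum_i \sum_(j | P i j) two_point s t i * two_point s t j
   = (P s s + P s t) + (P t s + P t t))%N.
Proof.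
under eq_bigr => i _.
  rewrite -big_distrr big_mkcond /=.
  rewrite (eq_bigr (fun j => two_point s t j * P i j)%N); last first.
    by move=> j _; case: (P i j); rewrite ?muln1 ?muln0.
  rewrite sum_two_point.
over.
by rewrite sum_two_point.
Qed.

Lemma mulU_two_point r (M : finType) (U : 'I_r -> M -> nat) (s t : M) i :
  mulU U (two_point s t) i = (U i s + U i t)%N.
Proof.
by rewrite ffunE; under eq_bigr => j _ do rewrite mulnC; rewrite sum_two_point.
Qed.

Lemma segment_ex n x y : (x <= y)%N -> (y < n.-1)%N ->
  exists s : segment n, lo s = x /\ hi s = y.
Proof.
move=> xy yn; have xn := leq_ltn_trans xy yn.
by exists (exist _ (Ordinal xn, Ordinal yn) xy).
Qed.

Lemma equivalent_equioriented n (Q : quiverA n) :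
  equivalent_via (@seg_pair n) (identityI Q) (identityII n) -> equioriented Q.
Proof.
case=> -[g phiK gK] _ eqf.
pose tr (m : {ffun segment n -> nat}) : {ffun ipair n -> nat} :=
  [ffun p => m (g p)].
have trE (m : {ffun segment n -> nat}) j : m j = tr m (seg_pair j).
  by rewrite ffunE phiK.
have tr2 u v : tr (two_point u v) = two_point (seg_pair u) (seg_pair v).
  by apply/ffunP => p; rewrite !ffunE -!(can_eq gK) !phiK.
have key u v := eqf _ _ _ (trE (two_point u v)) erefl.
have fstE (u : segment n) : fst_ix (seg_pair u) = lo u by [].
have sndE (u : segment n) : snd_ix (seg_pair u) = (hi u).+1 by [].
have adj (a b : 'I_n.-2) : b = a.+1 :> nat -> Q a = Q b.
  move=> ab; apply/eqP; apply: contraT => Qab.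
  have bn : (b.+1 < n.-1)%N by have := ltn_ord b; lia.
  have [s [los his]] := segment_ex (leqnn b) (ltnW bn).
  have [t [lot hit]] : exists t : segment n, lo t = a /\ hi t = b.+1.
    by apply: segment_ex bn; rewrite ab; lia.
  have [s' [los' his']] : exists s : segment n, lo s = a /\ hi s = b.
    by apply: segment_ex (ltnW bn); rewrite ab.
  have [t' [lot' hit']] := segment_ex (leqnSn b) bn.
  have dd : diff_dir Q b b.
    by apply/existsP; exists a; apply/existsP; exists b; rewrite ab !eqxx Qab.
  have ds : same_dir Q b b = false.
    apply/negbTE/existsP => -[x /existsP[y /and3P[/eqP xb /eqP yb Qxy]]].
    have ex : x = a by apply/val_inj/succn_inj; rewrite xb ab.
    have ey : y = b by apply/val_inj.
    by move: Qxy; rewrite ex ey (negPf Qab).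
  have eqU : mulU (qidU (identityI Q)) (two_point s t)
             = mulU (qidU (identityI Q)) (two_point s' t').
    apply/ffunP => i; rewrite [LHS]mulU_two_point [RHS]mulU_two_point /=.
    rewrite los his lot hit los' his' lot' hit'.
    move: (nat_of_ord i) (nat_of_ord a) (nat_of_ord b) ab => x y z.
    by clear; lia.
  have c1 : codim_pair Q s t by rewrite /codim_pair los his lot hit dd; lia.
  have c2 : [/\ codim_pair Q s' t' = false, codim_pair Q s' s' = false,
                codim_pair Q t' s' = false & codim_pair Q t' t' = false].
    by rewrite /codim_pair los' his' lot' hit' ds; split; lia.
  have c3 (u : segment n) : Bprime_pair (seg_pair u) (seg_pair u).
    by rewrite /Bprime_pair !fstE !sndE; have : (lo u <= hi u)%N := valP u; lia.
  have c4 : [/\ Bprime_pair (seg_pair s) (seg_pair t) = false,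
                Bprime_pair (seg_pair t) (seg_pair s) = false &
                Bprime_pair (seg_pair s') (seg_pair t')].
    rewrite /Bprime_pair !fstE !sndE los his lot hit los' his' lot' hit'.
    by split; lia.
  case: c2 c4 => c21 c22 c23 c24 [c41 c42 c43].
  have codimE u v : qidB (identityI Q) (two_point u v)
      = (codim_pair Q u u + codim_pair Q u v
         + (codim_pair Q v u + codim_pair Q v v))%:R.
    exact: (congr1 _ (pairs_two_point (codim_pair Q) u v)).
  have BprimeE p p' : qidB (identityII n) (two_point p p')
      = (Bprime_pair p p + Bprime_pair p p'
         + (Bprime_pair p' p + Bprime_pair p' p'))%:R.
    exact: (congr1 _ (pairs_two_point (@Bprime_pair n) p p')).
  have := key s' t'; have := key s t; rewrite -eqU.
  rewrite !tr2 !codimE !BprimeE.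
  rewrite c1 c21 c22 c23 c24 !c3 c41 c42 c43 /= !natrD.
  have := ler0n rat (codim_pair Q s s); have := ler0n rat (codim_pair Q t s).
  have := ler0n rat (codim_pair Q t t).
  by have := ler0n rat (Bprime_pair (seg_pair t') (seg_pair s')); lra.
suff E k (a b : 'I_n.-2) : b = (a + k)%N :> nat -> Q a = Q b.
  move=> a b; case/orP: (leq_total a b) => le; [|symmetry];
  by apply: (E _ _ _ (esym (subnKC le))).
elim: k a b => [|k IH] a b ab; first by congr Q; apply/val_inj; rewrite /= ab addn0.
have lt : (a + k < n.-2)%N by have := ltn_ord b; lia.
by rewrite (IH a (Ordinal lt) erefl); apply: adj; rewrite ab addnS.
Qed.

(* Main.v *)
(* Write <I, J> for the Euler form of the equioriented quiver, so that
   k A k^T / 2 = \sum_(I, J) m_I m_J <I, J> when k is the dimension vector of m.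
   Telescoping gives <[a, b], [c, d]> = [c <= a <= d] - [c <= b + 1 <= d], while
   for an equioriented quiver [a, b], [c, d] contributes to the codimension iff
   a < c <= b + 1 <= d.  The two add up to [c <= a <= d <= b], which is the
   condition for the pair ([c, d], [a, b]) to contribute to B'.  So the two
   quadratic forms agree coefficientwise, after exchanging I and J in B'. *)

Require Import Defs.
From mathcomp Require Import all_boot all_order all_algebra.
From mathcomp Require Import zify ring.
From mathcomp Require Import boolp.

Set Implicit Arguments.
Unset Strict Implicit.
Unset Printing Implicit Defensive.

Import GRing.Theory.
Local Open Scope ring_scope.

Lemma seg_pair_inj n : injective (@seg_pair n).
Proof.
move=> [[a b] ab] [[c d] cd] [eq_ac eq_bd].
by apply/val_inj; congr (_, _); apply/val_inj.
Qed.

Lemma seg_pair_bij n : bijective (@seg_pair n).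
Proof.
have surj (p : ipair n) : exists s, seg_pair s = p.
  case: p => [[a b] /= ab].
  (* The preimage of (a, b) is the segment [a, b - 1]; a < b makes b positive, so [b.-1] is a
     genuine predecessor. *)
  have abn : (a <= b.-1)%N by lia.
  have bn : (b.-1 < n.-1)%N by have := ltn_ord b; lia.
  have [s [los his]] := segment_ex abn bn.
  exists s; apply/val_inj; congr (_, _); apply/val_inj => /=.
    exact: los.
  by rewrite -/(hi s) his; lia.
have [g gK] := choice surj.
by exists g => // s; apply: seg_pair_inj; rewrite gK.
Qed.

Lemma sum_segment_telescope (V : pzRingType) (r a b : nat) (f : nat -> V) :
  (a <= b)%N -> (b < r)%N ->
  \sum_(i < r) (a <= i <= b)%N%:R * (f i - f i.+1) = f a - f b.+1.
Proof.
move=> ab br.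
rewrite -(big_mkord xpredT (fun i => (a <= i <= b)%N%:R * (f i - f i.+1))).
rewrite -[RHS]opprB -telescope_sumr ?(leqW ab) // -sumrN.
rewrite (big_nat_widen a _ r) // (big_nat_widenl a 0) // [RHS]big_mkcond /=.
apply: eq_bigr => i _; rewrite ltnS andbC opprB.
by case: ifP => _; rewrite ?mul1r ?mul0r.
Qed.

(** The Cartan matrix is E + E^T, where E is the Euler matrix with entries [i = j] - [i + 1 = j];
    hence half of its quadratic form is the form of E alone. *)
Lemma halfform_cartanA r (k : {ffun 'I_r -> nat}) :
  halfform (cartanA r) k =
    \sum_(i < r) \sum_(j < r)
      (k i)%:R * (k j)%:R * ((i == j :> nat)%:R - (i.+1 == j)%:R).
Proof.
pose S (i j : 'I_r) : rat :=
  (k i)%:R * (k j)%:R * ((i == j :> nat)%:R - (i.+1 == j)%:R).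
have -> : halfform (cartanA r) k = 1 / 2 * \sum_i \sum_j (S i j + S j i).
  rewrite /halfform mxE; congr (_ * _).
  rewrite exchange_big; apply: eq_bigr => j _ /=.
  rewrite !mxE mulr_suml; apply: eq_bigr => i _; rewrite !mxE /S !val_eqE.
  have [->|ij] := eqVneq i j.
    by rewrite (_ : (j.+1 == j) = false) //=; [ring|lia].
  case: eqP => [eq1|_]; case: eqP => [eq2|_] /=; [lia|ring..].
under eq_bigr do rewrite big_split /=.
rewrite big_split /= [X in _ + X]exchange_big /=.
by rewrite -/S; field.
Qed.

Lemma sum_ord_indic (V : pzRingType) r (f : nat -> V) (i : nat) :
  (forall j, (r <= j)%N -> f j = 0) ->
  \sum_(j < r) f j * (i == j :> nat)%:R = f i.
Proof.
move=> f0; have [ir|ri] := ltnP i r.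
  rewrite (bigD1 (Ordinal ir)) //= eqxx mulr1 big1 ?addr0 // => j jNi.
  by rewrite (_ : (i == j :> nat) = false) ?mulr0 // eq_sym; apply/negbTE.
rewrite f0 // big1 // => j _.
by rewrite (_ : (i == j :> nat) = false) ?mulr0 //; have := ltn_ord j; lia.
Qed.

(** The index is a natural number rather than a vertex, since [euler] evaluates it at [(hi I).+1],
    possibly past the last vertex. *)
Definition in_seg n (s : segment n) (i : nat) : rat := (lo s <= i <= hi s)%N%:R.

Definition euler n (I J : segment n) : rat :=
  in_seg J (lo I) - in_seg J (hi I).+1.

Lemma sum_euler n (I J : segment n) :
  \sum_(i < n.-1) \sum_(j < n.-1)
    in_seg I i * in_seg J j * ((i == j :> nat)%:R - (i.+1 == j)%:R) = euler I J.
Proof.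
(* At the last vertex i no j equals i + 1; the vanishing of [in_seg J] there lets [sum_ord_indic]
   cover this case too. *)
have J0 j : (n.-1 <= j)%N -> in_seg J j = 0.
  move=> nj; rewrite /in_seg [(j <= _)%N](_ : _ = false) ?andbF //.
  by have : (hi J < n.-1)%N := ltn_ord _; lia.
rewrite /euler -(@sum_segment_telescope _ n.-1) //; last exact: ltn_ord.
  apply: eq_bigr => i _.
  rewrite -(sum_ord_indic i J0) -(sum_ord_indic i.+1 J0) -sumrB mulr_sumr.
  by apply: eq_bigr => j _; rewrite -mulrBr mulrA.
exact: (valP I).
Qed.

(** Bilinear expansion: the dimension vector is the combination of the indicator vectors of segments
    with coefficients [m]. *)
Lemma halfform_dimension n (Q : quiverA n) (m : {ffun segment n -> nat}) :
  halfform (cartanA n.-1) (mulU (qidU (identityI Q)) m) =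
    \sum_(I : segment n) \sum_(J : segment n) (m I)%:R * (m J)%:R * euler I J.
Proof.
rewrite halfform_cartanA.
have dimE i : (mulU (qidU (identityI Q)) m i)%:R
    = \sum_(I : segment n) in_seg I i * (m I)%:R :> rat.
  by rewrite ffunE natr_sum; apply: eq_bigr => I _; rewrite natrM.
transitivity (\sum_(i < n.-1) \sum_(j < n.-1)
    \sum_(I : segment n) \sum_(J : segment n)
    (m I)%:R * (m J)%:R *
    (in_seg I i * in_seg J j * ((i == j :> nat)%:R - (i.+1 == j)%:R))).
  apply: eq_bigr => i _; apply: eq_bigr => j _.
  rewrite !dimE !mulr_suml; apply: eq_bigr => I _.
  rewrite mulr_sumr mulr_suml; apply: eq_bigr => J _; ring.
under eq_bigr do rewrite exchange_big /=.
rewrite exchange_big /=; apply: eq_bigr => I _.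
under eq_bigr do rewrite exchange_big /=.
rewrite exchange_big /=; apply: eq_bigr => J _.
rewrite -sum_euler mulr_sumr; apply: eq_bigr => i _.
by rewrite mulr_sumr.
Qed.

(** With all arrows alike, case (3) is void and the direction test in case (2) always succeeds; case
    (1) supplies the boundary value [lo J = (hi I).+1]. *)
Lemma codim_pair_equioriented n (Q : quiverA n) (I J : segment n) :
  equioriented Q ->
  codim_pair Q I J =
    [&& (lo I < lo J)%N, (lo J <= (hi I).+1)%N & (hi I < hi J)%N].
Proof.
move=> hQ.
have hI : (lo I <= hi I)%N := valP I.
have hJ : (lo J <= hi J)%N := valP J.
have nodiff x y : diff_dir Q x y = false.
  apply/negbTE/existsP => -[a /existsP[b /and3P[_ _]]].
  by rewrite (hQ a b) eqxx.
have same : (lo I < lo J)%N -> (lo J <= hi I)%N -> (hi I < hi J)%N ->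
    same_dir Q (lo J) (hi I).
  move=> h1 h2 h3; have h4 : (hi J < n.-1)%N := ltn_ord _.
  (* The arrows to compare are [(lo J).-1] and [hi I]; the first exists because [lo I < lo J] makes
     [lo J] positive. *)
  have ha : ((lo J).-1 < n.-2)%N by lia.
  have hb : (hi I < n.-2)%N by lia.
  apply/existsP; exists (Ordinal ha); apply/existsP; exists (Ordinal hb).
  by rewrite (hQ (Ordinal ha) (Ordinal hb)) /= !eqxx andbT andbT; lia.
rewrite /codim_pair nodiff !andbF orbF.
by apply/idP/idP; move: same; case: (same_dir _ _ _) => same; lia.
Qed.

Lemma codim_pair_euler n (Q : quiverA n) (I J : segment n) :
  equioriented Q ->
  (codim_pair Q I J)%:R + euler I J
  = (Bprime_pair (seg_pair J) (seg_pair I))%:R.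
Proof.
move=> hQ; rewrite codim_pair_equioriented // /euler /in_seg /Bprime_pair.
rewrite /fst_ix /snd_ix /= -/(lo I) -/(lo J) -/(hi I) -/(hi J).
have hI : (lo I <= hi I)%N := valP I.
have hJ : (lo J <= hi J)%N := valP J.
(* Moving the negative indicator to the right leaves an identity in naturals. With I = [a, b] and J
   = [c, d], it holds because [c <= b + 1 <= d] splits according to a < c or c <= a. *)
apply/eqP; rewrite addrA subr_eq -!natrD; apply/eqP; congr _%:R; lia.
Qed.

Lemma natr_sum_pairs (V : pzRingType) (M : finType) (P : rel M) (m : M -> nat) :
  (\sum_i \sum_(j | P i j) m i * m j)%N%:R
  = \sum_i \sum_j (m i)%:R * (m j)%:R * (P i j)%:R :> V.
Proof.
rewrite natr_sum; apply: eq_bigr => i _.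
rewrite natr_sum big_mkcond; apply: eq_bigr => j _.
by case: (P i j); rewrite ?natrM ?mulr1 ?mulr0.
Qed.

Lemma Bprime_seg_pair n (m : {ffun ipair n -> nat}) :
  (Bprime m)%:R = \sum_I \sum_J (m (seg_pair I))%:R * (m (seg_pair J))%:R
                    * (Bprime_pair (seg_pair J) (seg_pair I))%:R :> rat.
Proof.
have bij := onW_bij [pred i | true] (seg_pair_bij n).
rewrite /Bprime natr_sum_pairs exchange_big (reindex _ bij) /=.
apply: eq_bigr => I _; rewrite (reindex _ bij) /=.
by apply: eq_bigr => J _; rewrite (mulrC (m (seg_pair J))%:R).
Qed.

Theorem theorem5p4 (n : nat) (hn : (2 <= n)%N) (Q : quiverA n)
    (hQ : equioriented Q) :
  equivalent_via (@seg_pair n) (identityI Q) (identityII n).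
Proof.
split=> [|i s|k m1 m2 m12 <-]; first exact: seg_pair_bij.
  by rewrite /= /fst_ix /snd_ix /= ltnS.
rewrite [qidA (identityII n)]/= halfform_dimension /=.
rewrite /halfform mulmx0 mul0mx mxE mulr0 subr0.
(* The claim becomes codim + (Cartan form) / 2 = B', which is compared pair by pair. *)
apply/eqP; rewrite eq_sym subr_eq eq_sym; apply/eqP.
rewrite Bprime_seg_pair /codim natr_sum_pairs -big_split.
apply: eq_bigr => I _; rewrite -big_split; apply: eq_bigr => J _ /=.
by rewrite -mulrDr codim_pair_euler // !m12.
Qed.
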